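(* Let $n\ge 1$ and let $\psi:\mathcal{I}(\mathfrak{S}_n)\to M_n$ be the map which sends an involution $w$ to the Motzkin path $\psi(w)$ whose $k$-th step ($k\in[n]$) is a flatstep, upstep or downstep if $k$ is a fixed point, an excedance or a deficiency of $w$, respectively. Then $\psi$ induces a bijection between the Boolean involutions in $\mathcal{I}(\mathfrak{S}_n)$ and the set $M_n^{\mathrm{r}}$ of restricted Motzkin paths of length $n$.
   Context: $\mathfrak{S}_n$ is the group of permutations of $[n]=\{1,\dots,n\}$ and $\mathcal{I}(\mathfrak{S}_n)$ its set of involutions (elements of order at most two, including the identity). An index $k$ is an excedance of $w$ if $w(k)>k$ and a deficiency if $w(k)<k$. For $w\in\mathcal{I}(\mathfrak{S}_n)$, let $B(w)=\{u\in\mathcal{I}(\mathfrak{S}_n):u\le w\}$, ordered by the restriction of the (strong) Bruhat order $\le$ on $\mathfrak{S}_n$ (Coxeter generators: adjacent transpositions); $w$ is Boolean if $B(w)$ is isomorphic to a Boolean lattice. A Motzkin path of length $n$ is a lattice path from $(0,0)$ to $(n,0)$ which never goes below the $x$-axis and whose steps are $(1,1)$ (upsteps), $(1,0)$ (flatsteps) or $(1,-1)$ (downsteps). $M_n$ is the set of Motzkin paths of length $n$. $M_n^{\mathrm{r}}\subseteq M_n$ is the set of restricted Motzkin paths: those that never go higher than level $2$ and whose flatsteps all occur on level at most $1$ (level meaning $y$-coordinate). *)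

(* Defs.v *)
From HB Require Import structures.
From mathcomp Require Import all_boot all_order all_algebra all_fingroup.
From mathcomp Require Import zify.

Set Implicit Arguments.
Unset Strict Implicit.
Unset Printing Implicit Defensive.

Import Order.TTheory GRing.Theory Num.Theory.

(* Permutations act on 'I_n, so the index k of [n] is represented by k - 1;
   excedances, deficiencies and fixed points are unaffected by this shift. *)

Definition adj_transps (n : nat) : {set 'S_n} :=
  [set t | [exists i : 'I_n, exists j : 'I_n,
              (j == i.+1 :> nat) && (t == tperm i j)]].

Lemma adj_transps_gen n (w : 'S_n) : w \in <<adj_transps n>>%g.
Proof.
suff tperm_gen d (i j : 'I_n) :
    j = i + d :> nat -> tperm i j \in <<adj_transps n>>%g.
  have [ts -> _] := prod_tpermP w.
  apply: group_prod => -[i j] _ /=.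
  case: (leqP i j) => [le_ij | /ltnW le_ji].
    by apply: (tperm_gen (j - i)); rewrite subnKC.
  by rewrite tpermC; apply: (tperm_gen (i - j)); rewrite subnKC.
elim: d j => [|d IHd] j def_j.
  have -> : i = j by apply: val_inj; rewrite /= def_j addn0.
  by rewrite tperm1 group1.
have lt_k : i + d < n by have := ltn_ord j; lia.
pose k := Ordinal lt_k.
have adj_kj : tperm k j \in <<adj_transps n>>%g.
  apply: mem_gen; rewrite inE; apply/existsP; exists k.
  by apply/existsP; exists j; rewrite eqxx andbT /= def_j addnS.
have [-> // | neq_ik] := eqVneq i k.
have <- : (tperm i k ^ tperm k j)%g = tperm i j.
  rewrite tpermJ tpermL tpermD //; first by rewrite eq_sym.
  by apply/eqP => eq_ji; move: def_j; rewrite eq_ji; lia.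
exact: groupJ (IHd k erefl) adj_kj.
Qed.

Lemma adj_transps_word n (w : 'S_n) : exists k, w \in (adj_transps n ^+ k)%g.
Proof.
have /gen_prodgP[k [c Sc ->]] := adj_transps_gen w.
exists k; have := mem_prodg (fun i (_ : true) => Sc i).
by rewrite prodg_const card_ord.
Qed.

(* [A ^+ k] is the set of all products of k elements of A: this is the least
   number of adjacent transpositions in a word for w. *)
Definition coxeter_length n (w : 'S_n) : nat := ex_minn (adj_transps_word w).

Definition bruhat_step n : rel 'S_n := fun u w =>
  [exists i, exists j, w == (u * tperm i j)%g]
  && (coxeter_length u < coxeter_length w).

Definition bruhat_le n : rel 'S_n := connect (@bruhat_step n).

Record involution (n : nat) := Involution {
  perm_of_involution :> 'S_n;
  involutionP : (perm_of_involution ^+ 2 == 1)%g }.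

HB.instance Definition _ n := [isSub for @perm_of_involution n].
HB.instance Definition _ n := [Finite of involution n by <:].

Definition bruhat_below n (w : involution n) : {set involution n} :=
  [set u : involution n | bruhat_le u w].

Definition boolean_involution n (w : involution n) : Prop :=
  exists (r : nat) (f : involution n -> {set 'I_r}),
    [/\ {in bruhat_below w &, injective f},
        f @: bruhat_below w = [set: {set 'I_r}] &
        {in bruhat_below w &,
          {mono f : u v / bruhat_le u v >-> u \subset v}}].

Inductive step := Up | Flat | Down.

Definition option_of_step s :=
  match s with Up => Some true | Flat => None | Down => Some false end.
Definition step_of_option b :=
  match b with Some true => Up | None => Flat | Some false => Down end.
Lemma option_of_stepK : cancel option_of_step step_of_option.
Proof. by case. Qed.
HB.instance Definition _ := Finite.copy step (can_type option_of_stepK).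

Definition rise (s : step) : int :=
  match s with Up => 1 | Flat => 0 | Down => -1 end.

(* The k-th vertex of the path is (k, height p k). *)
Definition height n (p : n.-tuple step) (k : nat) : int :=
  (\sum_(i < n | (i < k)%N) rise (tnth p i))%R.

Definition is_motzkin n (p : n.-tuple step) : bool :=
  [forall k : 'I_n.+1, (0 <= height p k)%R] && (height p n == 0%R).

Record motzkin (n : nat) := Motzkin {
  steps :> n.-tuple step;
  motzkinP : is_motzkin steps }.

HB.instance Definition _ n := [isSub for @steps n].
HB.instance Definition _ n := [Finite of motzkin n by <:].

(* The flatstep number k runs from (k, y) to (k + 1, y) with y = height p k. *)
Definition restricted n (p : motzkin n) : bool :=
  [forall k : 'I_n.+1, (height p k <= 2)%R]
  && [forall k : 'I_n, (tnth p k == Flat) ==> (height p k <= 1)%R].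

Definition psi_steps n (w : 'S_n) : n.-tuple step :=
  [tuple if k < w k then Up else if w k < k then Down else Flat | k < n].

Lemma height_psi n (w : 'S_n) k :
  height (psi_steps w) k =
    (#|[set i : 'I_n | (i < k)%N & (i < w i)%N]|%:Z
     - #|[set i : 'I_n | (i < k)%N & (w i < i)%N]|%:Z)%R.
Proof.
rewrite -!sum1_card !(big_morph Posz PoszD (erefl (Posz 0))).
rewrite [X in (X - _)%R]big_mkcond [X in (_ - X)%R]big_mkcond -sumrB.
rewrite /height big_mkcond /=; apply: eq_bigr => i _.
by rewrite tnth_mktuple !inE; case: (i < k); case: ltngtP.
Qed.

Lemma psi_motzkin n (w : involution n) : is_motzkin (psi_steps w).
Proof.
have wK (i : 'I_n) : w (w i) = i.
  have /eqP/permP/(_ i) := involutionP w.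
  by rewrite expgS expg1 permM perm1.
apply/andP; split.
  apply/forallP => k; rewrite height_psi subr_ge0 lez_nat.
  rewrite -(card_imset _ (@perm_inj _ w)); apply: subset_leq_card.
  apply/subsetP => _ /imsetP[i /[!inE] /andP[lt_ik lt_wi] ->].
  by rewrite wK lt_wi (ltn_trans lt_wi).
rewrite height_psi subr_eq0 eqz_nat.
rewrite -[X in _ == X](card_imset _ (@perm_inj _ w)).
apply/eqP; congr #|pred_of_set _|.
apply/setP => i; rewrite inE ltn_ord /=.
apply/idP/imsetP => [lt_iw | [j /[!inE] /andP[_ lt_wj] ->]]; last by rewrite wK.
by exists (w i); rewrite ?inE wK ?ltn_ord.
Qed.

Definition psi n (w : involution n) : motzkin n := Motzkin (psi_motzkin w).

(* Main.v *)
(* For an involution w and a cut between k - 1 and k, let c_k(w) be the number of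
   arcs {i < w i} crossing the cut; this is the height of psi w at k, and it is
   monotone in the Bruhat order. Call w tame if no two of its arcs are nested, at
   most two arcs cross any cut, and no fixed point lies under two arcs; that is, w
   is nonnesting and psi w is restricted. A nonnesting w is recovered from psi w by
   matching upsteps with downsteps first in, first out, so everything reduces to
   "Boolean iff tame".
   The atoms of B(w) are the simple transpositions at the cuts crossed by w. If
   B(w) is Boolean, an element is hence determined by the set of cuts it crosses,
   whereas failure of tameness yields a smaller involution crossing the same cuts
   as w. Conversely, if w is tame then the elements of B(w) are tame, two adjacent
   cuts cannot both be crossed twice, and the rank conditions around a cut crossed
   twice show that elements of B(w) are determined by their crossed cuts; any
   single cut can be removed by going down, so B(w) is the lattice of subsets of
   the set of cuts crossed by w. *)

Require Import Defs.
From mathcomp Require Import all_boot classical_sets functions.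
(* [all_boot] again: [classical_sets] shadows the finite-set lemmas. *)
From mathcomp Require Import all_boot all_algebra all_fingroup zify.

Set Implicit Arguments.
Unset Strict Implicit.
Unset Printing Implicit Defensive.

Import GRing.Theory Num.Theory.

Local Open Scope group_scope.

Lemma ord_neq n (i j : 'I_n) : i <> j -> i != j :> nat.
Proof. by move/eqP. Qed.

(** * Coxeter length and inversions *)

Definition inversions n (w : 'S_n) : {set 'I_n * 'I_n} :=
  [set p : 'I_n * 'I_n | (p.1 < p.2) && (w p.2 < w p.1)].

Definition inv n (w : 'S_n) : nat := #|inversions w|.

(** Products act left to right, so [tperm x y * w] is [w] with the values at positions [x] and [y]
    exchanged. The map [g] carries an inversion along the exchange when its ends stay in order and
    keeps it otherwise; it is injective on the inversions of [w], lands in those of the product and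
    misses [(x, y)]. *)
Lemma inv_tperm n (w : 'S_n) (x y : 'I_n) :
  x < y -> w x < w y -> inv w < inv (tperm x y * w).
Proof.
move=> lt_xy lt_w; pose t := tperm x y.
pose g (p : 'I_n * 'I_n) := if t p.1 < t p.2 then (t p.1, t p.2) else p.
have tK : involutive t by apply: tpermK.
have g_inj : {in inversions w &, injective g}.
  move=> [a b] [c d]; rewrite !inE /g /= => /andP[lt_ab _] /andP[lt_cd _].
  case: ifP => lt_tab; case: ifP => lt_tcd [] // e1 e2.
  - by rewrite (perm_inj e1) (perm_inj e2).
  - by move: lt_tcd; rewrite -e1 -e2 !tK lt_ab.
  - by move: lt_tab; rewrite e1 e2 !tK lt_cd.
  - by rewrite e1 e2.
rewrite /inv -(card_in_imset g_inj); apply: proper_card; apply/properP; split.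
  apply/subsetP => _ /imsetP[[a b] + ->]; rewrite /g !inE /=.
  case/andP=> lt_ab lt_wba; case: ifP => /= [-> | ].
    by rewrite !permM -!/t !tK.
  rewrite !permM /t; case: tpermP => [ea|ea|_ _]; case: tpermP => [eb|eb|_ _];
    try subst a; try subst b; lia.
exists (x, y); first by rewrite inE /= !permM tpermL tpermR lt_xy.
apply/negP => /imsetP[[a b]]; rewrite !inE /g /= => /andP[lt_ab lt_wba].
case: ifP => _ [ex ey].
  have ea : a = y by rewrite -[a]tK -ex /t tpermL.
  have eb : b = x by rewrite -[b]tK -ey /t tpermR.
  by move: lt_ab; rewrite ea eb; lia.
by move: lt_wba; rewrite -ex -ey; lia.
Qed.

Lemma inv_tperm_le n (w : 'S_n) (x y : 'I_n) :
  y = x.+1 :> nat -> inv (tperm x y * w) <= (inv w).+1.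
Proof.
move=> def_y; pose t := tperm x y.
have tK : involutive t by apply: tpermK.
rewrite /inv (cardsD1 (x, y)) -addn1 addnC leq_add ?leq_b1 //.
pose g (p : 'I_n * 'I_n) := (t p.1, t p.2).
have g_inj : injective g.
  by move=> [a b] [c d] [/perm_inj-> /perm_inj->].
rewrite -(card_imset _ g_inj); apply: subset_leq_card.
apply/subsetP => _ /imsetP[[a b] + ->]; rewrite !inE /g /= !permM -/t.
case/and3P => ne lt_ab ->; rewrite andbT.
move: ne lt_ab; rewrite xpair_eqE /t.
case: tpermP => [->|->|/ord_neq na1 /ord_neq na2];
  case: tpermP => [->|->|/ord_neq nb1 /ord_neq nb2]; rewrite ?eqxx //=; lia.
Qed.

Lemma inv_eq0 n (w : 'S_n) : inv w = 0 -> w = 1.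
Proof.
move=> /cards0_eq inv0.
have w_homo (x y : 'I_n) : x < y -> w x < w y.
  move=> lt_xy; have := in_set0 (x, y); rewrite -inv0 inE /= lt_xy /=.
  have : w x != w y :> nat by apply: ord_neq => /perm_inj e; rewrite e ltnn in lt_xy.
  by lia.
have card_lt (k : 'I_n) : #|[set i : 'I_n | i < k]| = k.
  by rewrite cardsE -sum1_card big_ord_narrow ?sum1_card ?card_ord // ltnW.
apply/permP => x; rewrite perm1; apply/val_inj => /=.
(* An index equals the number of smaller indices, and the increasing [w] maps those below [x] onto
   those below [w x]. *)
rewrite -[RHS]card_lt -[LHS]card_lt -[RHS](card_imset _ (@perm_inj _ w)).
apply: eq_card => i; rewrite inE; apply/idP/imsetP => [lt_i | [j + ->]].
  exists (w^-1 i); last by rewrite permKV.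
  rewrite inE; case: (ltngtP (w^-1 i) x) => // [/w_homo|/val_inj e].
    by rewrite permKV; lia.
  by move: lt_i; rewrite -e permKV ltnn.
by rewrite inE => /w_homo.
Qed.

Lemma adjacent_descent n (w : 'S_n) : w != 1 ->
  exists x y : 'I_n, y = x.+1 :> nat /\ w y < w x.
Proof.
move=> w_neq1; have : inv w != 0 by apply: contra_neq w_neq1; apply: inv_eq0.
rewrite -lt0n => /card_gt0P[[x y]]; rewrite inE /= => /andP[].
have [d] := ubnP (y - x); elim: d x y => // d IHd x y le_d lt_xy lt_w.
have [def_y | ne] := eqVneq (y : nat) x.+1; first by exists x, y.
have lt_z : x.+1 < n by have := ltn_ord y; lia.
pose z := Ordinal lt_z.
have [lt_zx | ] := ltnP (w z) (w x); first by exists x, z.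
by move=> le_xz; apply: (IHd z y) => /=; lia.
Qed.

Lemma coxeter_lengthE n (w : 'S_n) : coxeter_length w = inv w.
Proof.
rewrite /coxeter_length; case: ex_minnP => k w_k min_k.
apply/eqP; rewrite eqn_leq; apply/andP; split; last first.
  elim: k w {min_k} w_k => [|k IHk] w.
    rewrite expg0 => /set1gP->; rewrite leqn0; apply/eqP/eq_card0 => -[x y].
    by rewrite !inE /= !perm1; lia.
  rewrite expgS => /mulsgP[t w' + /IHk w'_k ->]; rewrite inE.
  case/existsP=> i /existsP[j /andP[/eqP def_j /eqP->]].
  exact: leq_trans (inv_tperm_le _ def_j) _.
(* Sorting by adjacent descents, each of which removes exactly one inversion, spells [w] with
   [inv w] letters. *)
apply: min_k; have [m] := ubnP (inv w); elim: m w {w_k} => // m IHm w le_m.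
have [-> | w_neq1] := eqVneq w 1.
  suff -> : inv (1 : 'S_n) = 0 by rewrite expg0 set11.
  by apply: eq_card0 => -[x y]; rewrite !inE /= !perm1; lia.
have [x [y [def_y lt_w]]] := adjacent_descent w_neq1.
pose v := tperm x y * w; have def_w : w = tperm x y * v by rewrite tpermKg.
have lt_v : inv v < inv w.
  by rewrite def_w; apply: inv_tperm; rewrite ?permM ?tpermL ?tpermR // def_y.
have -> : inv w = (inv v).+1.
  by have := inv_tperm_le v def_y; rewrite -def_w; lia.
rewrite expgS def_w; apply: mem_mulg; last by apply: IHm; lia.
by rewrite inE; apply/existsP; exists x; apply/existsP; exists y; rewrite def_y !eqxx.
Qed.

(** * Bruhat order and rank conditions *)

Lemma bruhat_trans n (u v w : 'S_n) : bruhat_le u v -> bruhat_le v w -> bruhat_le u w.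
Proof. exact: connect_trans. Qed.

Lemma tperm_mul n (w : 'S_n) (x y : 'I_n) : tperm x y * w = w * tperm (w x) (w y).
Proof. by rewrite -tpermJ conjgE mulKVg. Qed.

(** The definition exchanges values; rank conditions are easier to follow when positions are
    exchanged. The increase of length becomes [u x < u y]. *)
Lemma bruhat_stepP n (u w : 'S_n) : bruhat_step u w ->
  exists x y : 'I_n, [/\ x < y, u x < u y & w = tperm x y * u].
Proof.
case/andP=> /existsP[a /existsP[b /eqP def_w]]; rewrite !coxeter_lengthE.
pose x := u^-1 a; pose y := u^-1 b.
have {}def_w : w = tperm x y * u by rewrite tperm_mul !permKV.
move: x y def_w => x y.
wlog lt_xy : x y / x < y => [IH def_w lt_inv | ].
  case: (ltngtP x y) => [lt|gt|/val_inj e].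
  - exact: IH lt def_w lt_inv.
  - by apply: IH gt _ lt_inv; rewrite tpermC.
  - by move: lt_inv; rewrite def_w e tperm1 mul1g ltnn.
move=> def_w lt_inv; exists x, y; split=> //.
have [//|] := ltnP (u x) (u y); rewrite leq_eqVlt => /orP[/eqP/val_inj/perm_inj e|lt_u].
  by rewrite e ltnn in lt_xy.
have := @inv_tperm n w x y lt_xy; rewrite def_w !permM tpermL tpermR tpermKg.
by move=> /(_ lt_u); rewrite -def_w; lia.
Qed.

Lemma bruhat_tperm n (w : 'S_n) (x y : 'I_n) :
  x < y -> w y < w x -> bruhat_le (tperm x y * w) w.
Proof.
move=> lt_xy lt_w; apply: connect1; apply/andP; split.
  apply/existsP; exists (w y); apply/existsP; exists (w x).
  by rewrite tperm_mul -mulgA (tpermC (w y)) tperm2 mulg1.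
rewrite !coxeter_lengthE; rewrite -{2}[w](tpermKg x y).
by apply: inv_tperm; rewrite // !permM tpermL tpermR.
Qed.

(* For k = l these are the left ends of the arcs over the cut before position k,
   the height of [psi w] at k; in general, the Bruhat rank matrix counts them. *)
Definition crossing n (w : 'S_n) (k l : nat) : {set 'I_n} :=
  [set i : 'I_n | (i < k) && (l <= w i)].

(** Along one step, if both exchanged positions precede [k] the exchange permutes the counted
    positions; otherwise at most the earlier one is counted, and its value only grows. *)
Lemma crossing_mono n (u w : 'S_n) k l :
  bruhat_le u w -> #|crossing u k l| <= #|crossing w k l|.
Proof.
case/connectP => p; elim: p u => [|v p IH] u /= => [_ -> //|].
case/andP => /bruhat_stepP[x [y [lt_xy lt_u def_v]]] path_p def_w.
apply: leq_trans (IH v path_p def_w); rewrite def_v {v def_v path_p def_w IH}.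
have [lt_yk | le_ky] := ltnP y k.
  rewrite -(card_imset _ (@perm_inj _ (tperm x y))); apply: subset_leq_card.
  apply/subsetP => _ /imsetP[i + ->]; rewrite !inE permM tpermK => /andP[lt_ik ->].
  by rewrite andbT; case: tpermP => [_|_|_ _]; lia.
apply: subset_leq_card; apply/subsetP => i; rewrite !inE permM.
by case: tpermP => [->|->|//]; lia.
Qed.

(** Induction on the number of inversions. If the claim fails for [w], all inversions of [w] start
    at the same position [i], which leaves only [w = tperm x y], a contradiction. *)
Lemma bruhat_simple n (w : 'S_n) (x y : 'I_n) :
  y = x.+1 :> nat -> 0 < #|crossing w y y| -> bruhat_le (tperm x y) w.
Proof.
move=> def_y; have [m] := ubnP (inv w); elim: m w => // m IHm w le_m /card_gt0P[i].
rewrite inE => /andP[lt_iy le_yi].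
have [//|not_le] := boolP (bruhat_le (tperm x y) w).
(* Otherwise undoing any inversion of w must uncross the cut between x and y. *)
have uncross (a b : 'I_n) : a < b -> w b < w a ->
    forall j : 'I_n, j < y -> w (tperm a b j) < y.
  move=> lt_ab lt_w j lt_jy; rewrite ltnNge; apply: contra not_le => le_yj.
  apply: bruhat_trans (bruhat_tperm lt_ab lt_w); apply: IHm.
    have := @inv_tperm n (tperm a b * w) a b lt_ab.
    by rewrite !permM tpermL tpermR tpermKg => /(_ lt_w); lia.
  by apply/card_gt0P; exists j; rewrite inE lt_jy permM.
have inv_i (a b : 'I_n) : a < b -> w b < w a ->
    [/\ a = i, w b < y <= b & forall c : 'I_n, y <= c -> w c < y -> c = b].
  move=> lt_ab lt_w; have unc := uncross a b lt_ab lt_w.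
  have ea : a = i.
    apply/eqP; apply: contraT => na; have [eb | nb] := eqVneq b i.
      by move: lt_ab (unc a); rewrite tpermL eb; lia.
    by have := unc i lt_iy; rewrite tpermD //; lia.
  have := unc i lt_iy; rewrite -ea tpermL => lt_wb.
  have le_yb : y <= b.
    rewrite leqNgt; apply/negP => lt_by.
    by have := unc b lt_by; rewrite tpermR ea; lia.
  rewrite lt_wb; split=> // c le_yc lt_wc; apply/eqP; apply: contraT => nc.
  (* Once uncrossed, [v] permutes the positions below [y], so no further [c] from the other side can
     be sent there. *)
  pose A := [set j : 'I_n | j < y]; pose v := tperm a b * w.
  have stab : v @: A = A.
    apply/eqP; rewrite eqEcard card_imset ?leqnn ?andbT; last exact: perm_inj.
    by apply/subsetP => _ /imsetP[j + ->]; rewrite !inE permM; apply: unc.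
  have : v c \in v @: A.
    rewrite stab inE permM tpermD // eq_sym //.
    by apply: contraTneq le_yc => ->; rewrite ea; lia.
  by case/imsetP=> j + /perm_inj e; rewrite -e inE; lia.
have w_neq1 : w != 1.
  by apply: contraTneq le_yi => ->; rewrite perm1; lia.
have [a [b [def_b lt_w]]] := adjacent_descent w_neq1.
have lt_ab : a < b by rewrite def_b.
have [ea /andP[lt_wb le_yb] uniq_b] := inv_i a b lt_ab lt_w.
have ex : a = x by apply: val_inj; move: le_yb lt_iy; rewrite -ea /=; lia.
have ey : b = y by apply: val_inj; move: def_b; rewrite ex /=; lia.
subst a b; rewrite ex in lt_w; clear le_yb lt_ab def_b.
suff w_t : tperm x y * w = 1.
  by rewrite -(tpermKg x y w) w_t mulg1 in not_le *; rewrite /bruhat_le connect0 in not_le.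
(* A descent left at [x] contradicts [lt_w]; any other one yields an inversion of [w] not starting
   at [x], or an inversion [(x, d)] with [d] beyond [y]. *)
apply/eqP; apply: contraT => /adjacent_descent[c [d [def_d]]]; rewrite !permM.
have w_inv (e f : 'I_n) : e < f -> w f < w e -> e = x.
  by rewrite -ex => lt_ef /(inv_i e f lt_ef)[].
case: (tpermP x y d) => [ed|ed|/ord_neq nd1 /ord_neq nd2].
- rewrite ed in def_d; rewrite tpermD; try by rewrite -val_eqE /=; lia.
  by move=> /(w_inv c y) ec; have := ec ltac:(lia); move/(congr1 val) => /=; lia.
- rewrite ed in def_d.
by have -> : c = x; [apply: val_inj => /=; lia | rewrite tpermL; lia].
case: tpermP => [ec|ec|/ord_neq nc1 _] lt_v.
- by rewrite ec in def_d; lia.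
- have lt_xd : x < d by rewrite ec in def_d; lia.
  have [_ _ uniq_d] := inv_i x d lt_xd lt_v.
  by move: (uniq_d y (leqnn _) lt_wb) => /(congr1 val) /=; lia.
by move: (w_inv c d ltac:(lia) lt_v) => /(congr1 val) /=; lia.
Qed.

(** * Boolean involutions are tame *)

Lemma involutionK n (w : involution n) : involutive w.
Proof.
by move=> x; have /eqP/permP/(_ x) := involutionP w; rewrite expgS expg1 permM perm1.
Qed.

Lemma involutive_sqr n (w : 'S_n) : involutive w -> w ^+ 2 == 1.
Proof. by move=> wK; apply/eqP/permP => x; rewrite expgS expg1 permM perm1 wK. Qed.

(** The cut [k] separates the positions below [k] from the others; the index 0 is never a crossed
    cut. *)
Definition cuts n (w : 'S_n) : {set 'I_n} :=
  [set k : 'I_n | 0 < #|crossing w k k|].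

Lemma mem_cuts n (w : 'S_n) (k : 'I_n) :
  reflect (exists i : 'I_n, i < k <= w i) (k \in cuts w).
Proof.
rewrite inE; apply: (iffP card_gt0P) => -[i]; rewrite ?inE => w_i; exists i => //.
by rewrite inE.
Qed.

Lemma cuts_mono n (u w : 'S_n) : bruhat_le u w -> cuts u \subset cuts w.
Proof.
move=> le_uw; apply/subsetP => k; rewrite !inE => u_k.
exact: leq_trans u_k (crossing_mono k k le_uw).
Qed.

Lemma cuts_neq0 n (w : involution n) : w != 1 :> 'S_n -> exists k, k \in cuts w.
Proof.
move=> w_neq1; have [x w_x] : exists x, w x != x.
  apply/existsP; apply: contraNT w_neq1 => /existsPn w_id.
  by apply/eqP/permP => x; rewrite perm1; apply/eqP; have := w_id x; rewrite negbK.
have [lt_x | le_x] := ltnP x (w x).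
  by exists (w x); apply/mem_cuts; exists x; rewrite lt_x leqnn.
exists x; apply/mem_cuts; exists (w x); rewrite involutionK leqnn andbT.
by rewrite ltn_neqAle le_x andbT.
Qed.

Lemma tperm_sqr n (x y : 'I_n) : tperm x y ^+ 2 == 1.
Proof. exact: involutive_sqr (tpermK x y). Qed.

(** The witness is the transposition of [k - 1] and [k]; the hypothesis guarantees that [k] has a
    predecessor. *)
Lemma cut_simple n (k : 'I_n) (w : 'S_n) : k \in cuts w ->
  exists s : involution n, k \in cuts s /\
    forall u : 'S_n, k \in cuts u -> bruhat_le s u.
Proof.
case/mem_cuts=> i /andP[lt_ik _]; have lt_x : k.-1 < n by have := ltn_ord k; lia.
pose x := Ordinal lt_x; have def_k : k = x.+1 :> nat by rewrite /=; lia.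
exists (Involution (tperm_sqr x k)) => /=; split.
  by apply/mem_cuts; exists x; rewrite tpermL leqnn def_k ltnSn.
by move=> u; rewrite inE; apply: bruhat_simple.
Qed.

Lemma one_sqr n : (1 : 'S_n) ^+ 2 == 1.
Proof. by rewrite expg1n. Qed.

Lemma bruhat_1le n (w : 'S_n) : bruhat_le 1 w.
Proof.
have [m] := ubnP (inv w); elim: m w => // m IHm w le_m.
have [-> | /adjacent_descent[x [y [def_y lt_w]]]] := eqVneq w 1.
  exact: connect0.
have lt_xy : x < y by rewrite def_y.
apply: bruhat_trans (bruhat_tperm lt_xy lt_w); apply: IHm.
have := @inv_tperm n (tperm x y * w) x y lt_xy.
by rewrite !permM tpermL tpermR tpermKg => /(_ lt_w); lia.
Qed.

(** In a Boolean lattice an element is the join of the atoms below it, and each atom is the simple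
    transposition at some crossed cut. *)
Lemma boolean_cuts_inj n (w : involution n) :
  boolean_involution w -> {in bruhat_below w &, injective (fun u : involution n => cuts u)}.
Proof.
case=> r [f [f_inj f_im f_mono]].
suff sub_f u v : u \in bruhat_below w -> v \in bruhat_below w ->
    cuts u = cuts v -> f u \subset f v.
  move=> u v le_u le_v eq_uv; apply: f_inj => //; apply/eqP.
  by rewrite eqEsubset !sub_f.
move=> le_u le_v eq_uv; apply/subsetP => a f_ua.
have one_below : Involution (one_sqr n) \in bruhat_below w.
  by rewrite inE bruhat_1le.
have below_trans (x y : involution n) :
    bruhat_le x y -> y \in bruhat_below w -> x \in bruhat_below w.
  by rewrite !inE; apply: bruhat_trans.
have f1 : f (Involution (one_sqr n)) = set0.
  have : set0 \in f @: bruhat_below w by rewrite f_im inE.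
  case/imsetP=> x le_x f_x; apply/eqP; rewrite -subset0 f_x f_mono //.
  exact: bruhat_1le.
have : [set a] \in f @: bruhat_below w by rewrite f_im inE.
case/imsetP=> x le_x f_x.
have le_xu : bruhat_le x u by rewrite -f_mono // -f_x sub1set.
have x_neq1 : x != 1 :> 'S_n.
  apply/eqP => x1; have e : x = Involution (one_sqr n) by apply: val_inj.
  by have := set11 a; rewrite f_x e f1 inE.
have [k x_k] := cuts_neq0 x_neq1.
have [s [s_k s_min]] := cut_simple x_k.
have le_sx := s_min x x_k; have le_s := below_trans s x le_sx le_x.
have le_sv : bruhat_le s v.
  by apply: s_min; rewrite -eq_uv; apply: subsetP (cuts_mono le_xu) k x_k.
(* Either [f s] is the singleton of [a], which then lies in [f v], or [f s] is empty and [s] is the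
   identity, which crosses no cut. *)
have : f s \subset [set a] by rewrite f_x f_mono.
rewrite subset1 => /orP[/eqP f_s | /eqP f_s].
  by apply: (subsetP (_ : f s \subset f v)); rewrite ?f_mono // f_s set11.
have /f_inj s1 : f s = f (Involution (one_sqr n)) by rewrite f_s f1.
by have /mem_cuts[i] := s_k; rewrite s1 //= perm1; lia.
Qed.

(* Deleting the arc at [a] would otherwise give a smaller involution with the same cuts. *)
Lemma boolean_private_cut n (w : involution n) (a : 'I_n) :
  boolean_involution w -> a < w a ->
  exists2 m : 'I_n, a < m <= w a & forall i : 'I_n, i < m <= w i -> i = a.
Proof.
move=> w_bool lt_a; have wK := involutionK w.
suff /existsP[m /andP[a_m /forallP m_priv]] :
    [exists m : 'I_n, (a < m <= w a) && [forall i : 'I_n, (i < m <= w i) ==> (i == a)]].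
  by exists m => // i m_i; apply/eqP; apply: implyP (m_priv i) m_i.
apply: contraT => /existsPn no_priv.
pose v := tperm a (w a) * w.
have v_a : v a = a by rewrite permM tpermL wK.
have v_wa : v (w a) = w a by rewrite permM tpermR.
have v_id x : x != a -> x != w a -> v x = w x.
  by move=> xa xwa; rewrite permM tpermD // eq_sym.
have vK : involutive v.
  move=> x; have [-> | xa] := eqVneq x a; first by rewrite !v_a.
  have [-> | xwa] := eqVneq x (w a); first by rewrite !v_wa.
  rewrite (v_id x) // v_id ?wK //; last by rewrite (can_eq wK).
  by rewrite -(can_eq wK) wK.
have le_vw : bruhat_le v w by apply: bruhat_tperm; rewrite ?wK.
pose V := Involution (involutive_sqr vK).
suff e : val V = w by move: lt_a; rewrite -e /= v_a ltnn.
congr val.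
apply: (boolean_cuts_inj w_bool); rewrite ?inE /bruhat_le ?connect0 //.
apply/eqP; rewrite eqEsubset cuts_mono //=.
apply/subsetP => m /mem_cuts[i w_i]; apply/mem_cuts.
have [ea | na] := eqVneq i a; last first.
  exists i; rewrite v_id //; apply: contraTneq w_i => ->; rewrite wK; lia.
subst i; have := no_priv m; rewrite w_i /= => /forallPn[j].
rewrite negb_imply => /andP[w_j nj]; exists j; rewrite v_id //.
by apply: contraTneq w_j => ->; rewrite wK; lia.
Qed.

(** The index [a] need not open an arc: if [w a <= a], the conclusion is automatic. Fixed points
    under an arc are thus allowed. *)
Definition nonnesting n (w : 'S_n) : Prop :=
  forall a b : 'I_n, a < b -> b < w b -> w a < w b.

Definition tame n (w : 'S_n) : Prop :=
  [/\ nonnesting w,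
      forall k : nat, #|crossing w k k| <= 2 &
      forall x : 'I_n, w x = x -> #|crossing w x x| <= 1].

(** Every cut under an inner arc is also under the outer one, so the inner arc would have no private
    cut. *)
Lemma boolean_nonnesting n (w : involution n) : boolean_involution w -> nonnesting w.
Proof.
move=> w_bool a b lt_ab lt_b.
have [m b_m m_priv] := boolean_private_cut w_bool lt_b.
rewrite ltnNge; apply/negP => le_w.
by have := m_priv a ltac:(lia) => e; rewrite e ltnn in lt_ab.
Qed.

(** Of three pairwise overlapping arcs, the outer two together cover every cut of the middle one,
    which would have no private cut. *)
Lemma boolean_cross_le2 n (w : involution n) k :
  boolean_involution w -> #|crossing w k k| <= 2.
Proof.
move=> w_bool; have w_nn := boolean_nonnesting w_bool.
have no3 (x y z : 'I_n) : x < y -> y < z -> z < k -> k <= w x ->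
    k <= w y -> k <= w z -> False.
  move=> lt_xy lt_yz lt_zk le_x le_y le_z.
  have lt_wxy := w_nn x y lt_xy ltac:(lia); have lt_wyz := w_nn y z lt_yz ltac:(lia).
  have lt_y : y < w y by lia.
  have [m y_m m_priv] := boolean_private_cut w_bool lt_y.
  have [le_m | lt_m] := leqP m (w x).
    by have e := m_priv x ltac:(lia); rewrite e ltnn in lt_xy.
  by have e := m_priv z ltac:(lia); rewrite e ltnn in lt_yz.
rewrite leqNgt; apply/negP => /card_gt2P[x [y [z [[]]]]].
rewrite !inE => /andP[x1 x2] /andP[y1 y2] /andP[z1 z2] [nxy nyz nzx].
have {nxy nyz nzx} [nxy nyz nzx] : [/\ x != y :> nat, y != z :> nat & z != x :> nat] by [].
case: (ltngtP x y) nxy => // xy _; case: (ltngtP y z) nyz => // yz _;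
  case: (ltngtP z x) nzx => // zx _; try lia.
- exact: (no3 x y z).
- exact: (no3 z x y).
- exact: (no3 x z y).
- exact: (no3 y z x).
- exact: (no3 y x z).
- exact: (no3 z y x).
Qed.

(** If arcs from [i < j] pass over [f], shortening the first to join [i] with [f] goes down without
    losing a cut: those between [f] and [w i] stay under the arc from [j]. *)
Lemma boolean_fixpoint_level n (w : involution n) (f : 'I_n) :
  boolean_involution w -> w f = f -> #|crossing w f f| <= 1.
Proof.
move=> w_bool w_f; have w_nn := boolean_nonnesting w_bool; have wK := involutionK w.
rewrite leqNgt; apply/negP => /card_gt1P[i [j []]]; rewrite !inE.
wlog lt_ij : i j / i < j => [IH |].
  move=> f_i f_j ne; have : i != j :> nat by [].
  by rewrite neq_ltn => /orP[lt|lt]; [apply: (IH i j) | apply: (IH j i); rewrite // eq_sym].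
case/andP=> lt_if le_fi /andP[lt_jf le_fj] _.
have lt_fi : f < w i.
  rewrite ltn_neqAle le_fi andbT; apply: contraTneq lt_if => /val_inj e.
  by rewrite -{1}[i]wK -e w_f ltnn.
have lt_w := w_nn i j lt_ij ltac:(lia).
(* 45312 > 35142, and both cross every cut. *)
pose u := tperm i f * w; pose v := tperm f (w i) * u.
have u_id x : x != i -> x != f -> u x = w x.
  by move=> xi xf; rewrite permM tpermD // eq_sym.
have u_f : u f = w i by rewrite permM tpermR.
have u_wi : u (w i) = i by rewrite u_id ?wK // -val_eqE /=; lia.
have v_i : v i = f.
  by rewrite permM tpermD ?permM ?tpermL // -val_eqE /=; lia.
have v_f : v f = i by rewrite permM tpermL.
have v_wi : v (w i) = w i by rewrite permM tpermR.
have v_id x : x != i -> x != f -> x != w i -> v x = w x.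
  by move=> xi xf xwi; rewrite permM tpermD 1?eq_sym // u_id.
have vK : involutive v.
  move=> x; have [-> | xi] := eqVneq x i; first by rewrite v_i.
  have [-> | xf] := eqVneq x f; first by rewrite v_f.
  have [-> | xwi] := eqVneq x (w i); first by rewrite !v_wi.
  rewrite (v_id x) // v_id ?wK //; last by rewrite (can_eq wK).
    by rewrite -(can_eq wK) wK.
  by rewrite -(can_eq wK) wK w_f.
have le_vw : bruhat_le v w.
  apply: (bruhat_trans (v := u)); apply: bruhat_tperm; rewrite ?u_wi ?u_f ?w_f //.
  exact: ltn_trans lt_fi.
pose V := Involution (involutive_sqr vK).
suff e : val V = w by move: lt_fi; rewrite -e /= v_i ltnn.
congr val; apply: (boolean_cuts_inj w_bool); rewrite ?inE /bruhat_le ?connect0 //.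
apply/eqP; rewrite eqEsubset cuts_mono //=.
apply/subsetP => m /mem_cuts[x w_x]; apply/mem_cuts.
have [xi | xi] := eqVneq x i; last first.
  exists x; rewrite v_id //; first by apply: contraTneq w_x => ->; rewrite w_f; lia.
  by apply: contraTneq w_x => ->; rewrite wK; lia.
rewrite xi in w_x; have [le_mf | lt_fm] := leqP m f.
  by exists i; rewrite v_i; lia.
by exists j; rewrite v_id; rewrite -?val_eqE /=; lia.
Qed.

Lemma boolean_tame n (w : involution n) : boolean_involution w -> tame w.
Proof.
move=> w_bool; split; first exact: boolean_nonnesting.
  by move=> k; apply: boolean_cross_le2.
by move=> x; apply: boolean_fixpoint_level.
Qed.

(** * Tame involutions are Boolean *)

(** Passing [x] opens the arc at [x] or closes the one ending there; the additive form avoids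
    truncated subtraction. *)
Lemma crossing_succ n (w : involution n) (x : 'I_n) :
  #|crossing w x.+1 x.+1| + (w x < x) = #|crossing w x x| + (x < w x).
Proof.
have wK := involutionK w.
have [lt_x | lt_x | /val_inj w_x] := ltngtP (w x) x.
- rewrite (_ : crossing w x x = w x |: crossing w x.+1 x.+1).
    by rewrite cardsU1 !inE wK ltnn andbF addn0 addnC.
  apply/setP => i; rewrite !inE; have [-> | ne] := eqVneq i (w x).
    by rewrite wK lt_x leqnn.
  have : w i != x :> nat by rewrite val_eqE -(can_eq wK) wK.
  have [->|] := eqVneq i x; first by lia.
  by rewrite -val_eqE /=; lia.
- rewrite (_ : crossing w x.+1 x.+1 = x |: crossing w x x).
    by rewrite cardsU1 !inE ltnn addn0 addnC.
  apply/setP => i; rewrite !inE; have [-> | ne] := eqVneq i x.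
    by rewrite ltnSn lt_x.
  have [e|] := eqVneq (w i) x; last by move: ne; rewrite -!val_eqE /=; lia.
  by move: lt_x; rewrite -e wK; lia.
congr (_ + _); apply: eq_card => i; rewrite !inE.
have [->|ne] := eqVneq i x; first by rewrite w_x; lia.
have : w i != x :> nat by rewrite val_eqE -(can_eq wK) wK w_x.
by move: ne; rewrite -val_eqE /=; lia.
Qed.

Lemma crossing_ord n (w : 'S_n) k : 0 < #|crossing w k k| ->
  exists a b : 'I_n, b = k :> nat /\ b = a.+1 :> nat.
Proof.
case/card_gt0P=> i; rewrite inE => /andP[lt_ik le_k].
have lt_k : k < n by apply: leq_ltn_trans (ltn_ord (w i)).
have lt_k' : k.-1 < n by lia.
by exists (Ordinal lt_k'), (Ordinal lt_k) => /=; split; lia.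
Qed.

(** By the level bounds, [a] must open an arc and [b] must close one. These arcs differ: if [a] were
    matched with [b], the other arc over the cut would start earlier and nest it. *)
Lemma tame_peak n (w : involution n) (a b : 'I_n) :
  tame w -> b = a.+1 :> nat -> (1 < #|crossing w b b|)%N ->
  [/\ b < w a, w b < a, #|crossing w a a| = 1%N, #|crossing w b.+1 b.+1| = 1%N &
      forall i : 'I_n, i < b -> b <= w i -> i = a \/ i = w b].
Proof.
move=> [w_nn w_le2 w_fix] def_b c_b; have wK := involutionK w.
have c_le k := w_le2 k.
have := crossing_succ w a; have := crossing_succ w b; rewrite -def_b => cb ca.
have lt_a : a < w a.
  case: (ltngtP a (w a)) => // [gt|/val_inj e].
    by have := c_le a; move: ca; lia.
  by have := w_fix a (esym e); move: ca; rewrite -e; lia.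
have lt_b : w b < b.
  case: (ltngtP b (w b)) => // [gt|/val_inj e].
    by have := c_le b.+1; move: cb; lia.
  by have := w_fix b (esym e); lia.
have ne_ab : w a != b :> nat.
  apply/eqP => e; case/card_gt1P: c_b => i [j []]; rewrite !inE.
  have only_a (l : 'I_n) : l < b -> b <= w l -> l = a.
    move=> lt_l le_l; apply: val_inj; case: (ltngtP l a) => //=; last by lia.
    by move=> lt_la; have := w_nn l a lt_la lt_a; lia.
  by move=> /andP[? ?] /andP[? ?]; rewrite (only_a i) // (only_a j) // eqxx.
have ne_ba : w b != a by rewrite -(can_eq wK) wK eq_sym.
have := c_le b => c_b2.
have {}ne_ba : w b != a :> nat by [].
split; try lia.
move=> i lt_ib le_bi; have [-> | na] := eqVneq i a; first by left.
have [-> | nb] := eqVneq i (w b); first by right.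
suff : 2 < #|crossing w b b| by lia.
apply/card_gt2P; exists a, (w b), i; rewrite !inE wK; split; first by split; lia.
by split; rewrite // 1?eq_sym.
Qed.

(** Of the two arcs over the cut, one starts at [a] and the other ends at [b]. As a rank condition,
    this vanishing passes to everything below [w]. *)
Lemma tame_peak0 n (w : involution n) (a b : 'I_n) :
  tame w -> b = a.+1 :> nat -> (1 < #|crossing w b b|)%N -> #|crossing w a b.+1| = 0.
Proof.
move=> w_tame def_b c_b; have [_ _ _ _ only] := tame_peak w_tame def_b c_b.
apply: eq_card0 => i; rewrite !inE; apply/negP => /andP[lt_i le_i].
have [e | e] := only i ltac:(lia) ltac:(lia); first by rewrite e ltnn in lt_i.
by move: le_i; rewrite e involutionK ltnn.
Qed.

Lemma tame_no_plateau n (w : involution n) k :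
  tame w -> (1 < #|crossing w k k|)%N -> #|crossing w k.+1 k.+1| <= 1.
Proof.
move=> w_tame c_k; have [a [b [def_k def_b]]] := crossing_ord (ltnW c_k).
by rewrite -def_k in c_k *; have [_ _ _ ->] := tame_peak w_tame def_b c_k.
Qed.

(** Cuts under a nested arc of [u] are crossed twice in [w], so the inner arc spans a single cut,
    and the outer arc contradicts the vanishing rank at that peak. A fixed point under two arcs
    would give two adjacent double cuts. *)
Lemma bruhat_tame n (u w : involution n) : bruhat_le u w -> tame w -> tame u.
Proof.
move=> le_uw w_tame; have [_ w_le2 _] := w_tame.
have mono k l := crossing_mono k l le_uw.
split.
- move=> a b lt_ab lt_b; rewrite ltnNge leq_eqVlt; apply/negP.
  move=> /orP[/eqP/val_inj/perm_inj e|lt_u].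
    by rewrite e ltnn in lt_ab.
  have peak k : b < k -> k <= u b -> (1 < #|crossing w k k|)%N.
    move=> lt_bk le_k; apply: leq_trans (mono k k); apply/card_gt1P.
    by exists a, b; rewrite !inE; split; [lia | lia | rewrite -val_eqE /=; lia].
  have c_b := peak b.+1 (ltnSn _) lt_b.
  have [lt_ub|] := ltnP b.+1 (u b).
    by have := tame_no_plateau w_tame c_b; have := peak b.+2; lia.
  move=> le_ub; have def_ub : u b = b.+1 :> nat by lia.
  rewrite -def_ub in c_b; have := tame_peak0 w_tame def_ub c_b.
  have := mono b (u b).+1; have : 0 < #|crossing u b (u b).+1|; last by lia.
  by apply/card_gt0P; exists a; rewrite inE lt_ab.
- by move=> k; apply: leq_trans (mono k k) (w_le2 k).
move=> x u_x; rewrite leqNgt; apply/negP => c_x.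
have := crossing_succ u x; rewrite u_x !ltnn !addn0 => c_x1.
have := tame_no_plateau w_tame (leq_trans c_x (mono x x)).
by have := mono x.+1 x.+1; lia.
Qed.

(** Recover the permutation from left to right. If an upstep [x] had partners [s x < t x], the
    partner of [s x] under [t] would lie before [x], where both agree, or open an arc nested under
    that of [x]. *)
Lemma nonnesting_inj n (u v : involution n) :
  nonnesting u -> nonnesting v ->
  (forall x : 'I_n, (x < u x) = (x < v x)) ->
  (forall x : 'I_n, (u x < x) = (v x < x)) -> u = v.
Proof.
move=> u_nn v_nn eq_exc eq_def; apply: val_inj; apply/permP => /= x.
have [m] := ubnP (x : nat); elim: m x => // m IHm x le_m.
have IH (y : 'I_n) : y < x -> u y = v y by move=> lt; apply: IHm; lia.
have uK := involutionK u; have vK := involutionK v.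
have [lt_u | lt_u | /val_inj e] := ltngtP (u x) x.
- by have := IH _ lt_u; rewrite uK => e; rewrite {2}e vK.
- have lt_v : x < v x by rewrite -eq_exc.
  have no_lt (s t : involution n) : involutive s -> involutive t -> nonnesting t ->
      (forall y : 'I_n, y < x -> s y = t y) ->
      (forall z : 'I_n, (s z < z) = (t z < z)) -> x < s x -> ~~ (s x < t x).
    move=> sK tK t_nn eq_st eq_d lt_s; apply/negP => lt_st.
    have lt_y : t (s x) < s x by rewrite -eq_d sK.
    case: (ltngtP (t (s x)) x) => [lt|gt|/val_inj e2].
    + by have := eq_st _ lt; rewrite tK => /perm_inj e2; rewrite e2 ltnn in lt.
    + by have := t_nn x (t (s x)) gt; rewrite tK; lia.
    + by move: lt_st; rewrite -{2}e2 tK ltnn.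
  apply: val_inj => /=; case: (ltngtP (u x) (v x)) => // lt_uv.
    by have := no_lt u v uK vK v_nn IH eq_def lt_u; rewrite lt_uv.
  have := no_lt v u vK uK u_nn _ _ lt_v; rewrite lt_uv => /(_ _ _)/negP [] // y.
  by move=> lt; rewrite IH.
apply: val_inj => /=; have := eq_exc x; have := eq_def x; rewrite e !ltnn; lia.
Qed.

(** It suffices that the crossed cuts determine the crossing numbers, since these give the
    excedances and deficiencies. *)
Lemma tame_cuts_inj n (w : involution n) :
  tame w -> {in bruhat_below w &, injective (fun u : involution n => cuts u)}.
Proof.
move=> w_tame u v; rewrite !inE => le_u le_v eq_uv.
have u_tame := bruhat_tame le_u w_tame; have v_tame := bruhat_tame le_v w_tame.
have cuts_gt0 (s t : involution n) k :
    cuts s = cuts t -> 0 < #|crossing s k k| -> 0 < #|crossing t k k|.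
  move=> eq_st c_k; have [_ [b [def_k _]]] := crossing_ord c_k.
  by rewrite -def_k in c_k *; move/setP/(_ b): eq_st; rewrite !inE c_k => <-.
have cuts_gt1 (s t : involution n) k :
    bruhat_le s w -> bruhat_le t w -> tame s -> cuts s = cuts t ->
    (1 < #|crossing s k k|)%N -> (1 < #|crossing t k k|)%N.
  move=> le_s le_t s_tame eq_st c_k; have tK := involutionK t.
  have [a [b [def_k def_b]]] := crossing_ord (ltnW c_k).
  rewrite -def_k in c_k *; rewrite ltnNge; apply/negP => t_b.
  have [_ _ s_a s_b1 _] := tame_peak s_tame def_b c_k.
  have w_k := leq_trans c_k (crossing_mono b b le_s).
  have [_ _ w_a w_b1 _] := tame_peak w_tame def_b w_k.
  have t_a : #|crossing t a a| = 1%N.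
    have := cuts_gt0 _ _ a eq_st; have := crossing_mono a a le_t; lia.
  have t_b1 : #|crossing t b.+1 b.+1| = 1%N.
    have := cuts_gt0 _ _ b.+1 eq_st; have := crossing_mono b.+1 b.+1 le_t; lia.
  have {}t_b : #|crossing t b b| = 1%N.
    by have := cuts_gt0 _ _ b eq_st; lia.
  (* If [t] crosses the peak only once, its levels around [a] and [b] are all 1, so both are fixed
     and one arc passes over them, which the vanishing rank of [w] forbids. *)
  have fix_a : t a = a.
    by apply: val_inj => /=; have := crossing_succ t a; rewrite -def_b; lia.
  have fix_b : t b = b.
    by apply: val_inj => /=; have := crossing_succ t b; lia.
  have /card_gt0P[i] : 0 < #|crossing t a a| by rewrite t_a.
  rewrite inE => /andP[lt_i le_i].
  have na : t i != a :> nat.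
    by rewrite val_eqE -fix_a (can_eq tK) -val_eqE /=; lia.
  have nb : t i != b :> nat.
    by rewrite val_eqE -fix_b (can_eq tK) -val_eqE /=; lia.
  have := crossing_mono a b.+1 le_t; rewrite (tame_peak0 w_tame def_b w_k).
  by rewrite leqn0 cards_eq0 => /eqP/setP/(_ i); rewrite !inE; lia.
have eq_c k : #|crossing u k k| = #|crossing v k k|.
  have [_ u_le2 _] := u_tame; have [_ v_le2 _] := v_tame.
  have := cuts_gt0 u v k eq_uv; have := cuts_gt0 v u k (esym eq_uv).
  have := cuts_gt1 u v k le_u le_v u_tame eq_uv.
  have := cuts_gt1 v u k le_v le_u v_tame (esym eq_uv).
  by have := u_le2 k; have := v_le2 k; lia.
have [u_nn _ _] := u_tame; have [v_nn _ _] := v_tame.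
by apply: nonnesting_inj => // x;
  have := crossing_succ u x; have := crossing_succ v x; rewrite !eq_c; lia.
Qed.

(** * Removing a single cut *)

Ltac ord_neq_tac :=
  first [done | by rewrite eq_sym | by rewrite -val_eqE /=; lia].

Ltac tperm_eval := rewrite ?permM; repeat
  match goal with |- context [fun_of_perm (tperm ?x ?y) ?z] => is_var z;
    first [ rewrite (tpermL z y) | rewrite (tpermR x z)
          | rewrite (tpermD (x := x) (y := y) (z := z)); [|ord_neq_tac|ord_neq_tac] ]
  end.

(** The arc from [i] to [j] is replaced by arcs from [i] to [p] and from [q] to [j], degenerating to
    fixed points when [p = i] or [q = j]. Each of [p], [q] interior to the arc costs one more
    downward transposition. *)
Lemma split_arc n (w : involution n) (i p q j : 'I_n) :
  i <= p -> p < q -> q <= j -> w i = j ->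
  p = i \/ w p = p -> q = j \/ w q = q ->
  exists2 u : involution n, bruhat_le u w &
    [/\ u i = p, u p = i, u q = j, u j = q &
        forall x, x != i -> x != p -> x != q -> x != j -> u x = w x].
Proof.
move=> le_ip lt_pq le_qj w_i w_p w_q; have wK := involutionK w.
have w_j : w j = i by rewrite -w_i wK.
suff [u le_u [u_i u_p u_q u_j u_id]] : exists2 u : 'S_n, bruhat_le u w &
    [/\ u i = p, u p = i, u q = j, u j = q &
        forall x, x != i -> x != p -> x != q -> x != j -> u x = w x].
  have uK : involutive u.
    move=> x; have [-> | xi] := eqVneq x i; first by rewrite u_i.
    have [-> | xp] := eqVneq x p; first by rewrite u_p.
    have [-> | xq] := eqVneq x q; first by rewrite u_q.
    have [-> | xj] := eqVneq x j; first by rewrite u_j.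
    rewrite (u_id x) // u_id ?wK // -(can_eq wK) wK ?w_i ?w_j //.
      by case: w_p => [-> | ->]; rewrite ?w_i.
    by case: w_q => [-> | ->]; rewrite ?w_j.
  by exists (Involution (involutive_sqr uK)).
have [e_p | n_p] := eqVneq p i; have [e_q | n_q] := eqVneq q j.
- exists (tperm i j * w).
    by apply: bruhat_tperm; rewrite ?w_i ?w_j; subst; lia.
  subst p q; split; tperm_eval; rewrite ?w_i ?w_j //.
  by move=> x ? ? ? ?; tperm_eval.
- have {}w_q : w q = q by case: w_q => // e; rewrite e eqxx in n_q.
  have {}n_q : q != j :> nat by [].
  subst p; exists (tperm i j * (tperm i q * w)).
    by apply: (bruhat_trans (v := tperm i q * w)); apply: bruhat_tperm;
      tperm_eval; rewrite ?w_i ?w_j ?w_q; lia.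
  split; tperm_eval => //.
  by move=> x ? ? ? ?; tperm_eval.
- have {}w_p : w p = p by case: w_p => // e; rewrite e eqxx in n_p.
  have {}n_p : p != i :> nat by [].
  subst q; exists (tperm p j * (tperm i p * w)).
    by apply: (bruhat_trans (v := tperm i p * w)); apply: bruhat_tperm;
      tperm_eval; rewrite ?w_i ?w_j ?w_p; lia.
  split; tperm_eval => //.
  by move=> x ? ? ? ?; tperm_eval.
have {}w_q : w q = q by case: w_q => // e; rewrite e eqxx in n_q.
have {}w_p : w p = p by case: w_p => // e; rewrite e eqxx in n_p.
have {}n_p : p != i :> nat by [].
have {}n_q : q != j :> nat by [].
exists (tperm p j * (tperm i p * (tperm i q * w))).
  apply: (bruhat_trans (v := tperm i p * (tperm i q * w))).
    by apply: bruhat_tperm; tperm_eval; rewrite ?w_i ?w_j ?w_p ?w_q; lia.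
  apply: (bruhat_trans (v := tperm i q * w)).
    by apply: bruhat_tperm; tperm_eval; rewrite ?w_i ?w_j ?w_p ?w_q; lia.
  by apply: bruhat_tperm; tperm_eval; rewrite ?w_i ?w_j ?w_p ?w_q; lia.
split; tperm_eval => //.
by move=> x ? ? ? ?; tperm_eval.
Qed.

(** The result is the conjugate of [w] by [tperm a b], reached by two downward exchanges of
    positions. *)
Lemma uncross_arcs n (w : involution n) (i a b j : 'I_n) :
  i < a -> b = a.+1 :> nat -> b < j -> w i = b -> w a = j ->
  exists2 u : involution n, bruhat_le u w &
    [/\ u i = a, u a = i, u b = j, u j = b &
        forall x, x != i -> x != a -> x != b -> x != j -> u x = w x].
Proof.
move=> lt_ia def_b lt_bj w_i w_a; have wK := involutionK w.
have w_b : w b = i by rewrite -w_i wK.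
have w_j : w j = a by rewrite -w_a wK.
pose u := tperm i j * (tperm a b * w).
have u_i : u i = a by rewrite /u; tperm_eval.
have u_j : u j = b by rewrite /u; tperm_eval.
have u_a : u a = i by rewrite /u; tperm_eval.
have u_b : u b = j by rewrite /u; tperm_eval.
have u_id x : x != i -> x != a -> x != b -> x != j -> u x = w x.
  by move=> ? ? ? ?; rewrite /u; tperm_eval.
have uK : involutive u.
  move=> x; have [-> | xi] := eqVneq x i; first by rewrite u_i.
  have [-> | xa] := eqVneq x a; first by rewrite u_a.
  have [-> | xb] := eqVneq x b; first by rewrite u_b.
  have [-> | xj] := eqVneq x j; first by rewrite u_j.
  by rewrite (u_id x) // u_id ?wK // -(can_eq wK) wK ?w_i ?w_j ?w_a ?w_b.
exists (Involution (involutive_sqr uK)) => //.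
apply: (bruhat_trans (v := tperm a b * w)); apply: bruhat_tperm;
  tperm_eval; rewrite ?w_i ?w_j ?w_a ?w_b; lia.
Qed.

(** At a peak, the two arcs are uncrossed and still cover all other cuts. A cut crossed once lies
    under one arc, which is split there. *)
Lemma tame_remove_cut n (w : involution n) (k : 'I_n) :
  tame w -> k \in cuts w ->
  exists2 u : involution n, bruhat_le u w & cuts u = cuts w :\ k.
Proof.
move=> w_tame; rewrite inE => c_k; have wK := involutionK w.
have [a [b [/val_inj def_k def_b]]] := crossing_ord c_k; subst k.
have [le_c | lt_c] := leqP #|crossing w b b| 1; last first.
  have [lt_a lt_b _ _ only] := tame_peak w_tame def_b lt_c.
  have [u le_u [u_i u_a u_b u_j u_id]] :=
    uncross_arcs lt_b def_b lt_a (wK b) (erefl (w a)).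
  exists u => //; apply/setP => m; rewrite in_setD1; have [-> | ne] := eqVneq m b.
    apply/mem_cuts => -[x x_b].
    have [e | xi] := eqVneq x (w b); first by move: x_b; rewrite e u_i; lia.
    have [e | xa] := eqVneq x a; first by move: x_b; rewrite e u_a; lia.
    have [e | xb] := eqVneq x b; first by move: x_b; rewrite e; lia.
    have [e | xj] := eqVneq x (w a); first by move: x_b; rewrite e; lia.
    move: x_b; rewrite u_id // => /andP[/only /[apply]] [] e.
      by rewrite e eqxx in xa.
    by rewrite e eqxx in xi.
  rewrite /=; apply/idP/idP; first exact/subsetP/cuts_mono.
  have {}ne : m != b :> nat by [].
  case/mem_cuts=> x w_x; apply/mem_cuts.
  have [e | xi] := eqVneq x (w b).
    by exists (w b); rewrite u_i; move: w_x; rewrite e wK; lia.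
  have [e | xa] := eqVneq x a.
    by exists b; rewrite u_b; move: w_x; rewrite e; lia.
  have [e | xb] := eqVneq x b; first by move: w_x; rewrite e; lia.
  have [e | xj] := eqVneq x (w a); first by move: w_x; rewrite e wK; lia.
  by exists x; rewrite u_id.
have {c_k} c_k : #|crossing w b b| = 1%N by lia.
have /eqP/cards1P[i def_c] := c_k.
have only (x : 'I_n) : x < b -> b <= w x -> x = i.
  by move=> lt_x le_x; apply/set1P; rewrite -def_c inE lt_x.
have /andP[lt_ib le_b] : i < b <= w i by have := set11 i; rewrite -def_c inE.
have ca := crossing_succ w a; have cb := crossing_succ w b.
rewrite -def_b in ca.
(* [p] and [q] are the right end of the left part and the left end of the right
   part of the arc at [i]; the neighbours [a], [b] of the cut may be occupied by
   an overlapping arc, which then covers the cut in between. *)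
have [p [le_ip le_pa w_p cov_p]] : exists p : 'I_n,
    [/\ i <= p, p <= a, p = i \/ w p = p & forall m : 'I_n, p < m -> m < b ->
      exists2 x : 'I_n, x != i & x < m <= w x].
  have [lt_a | lt_a | /val_inj w_a] := ltngtP (w a) a.
  (* An arc closing at [a] makes the cut before [a] a peak, so [i = a - 1] and that arc alone covers
     the cut given up by taking [p = i]. *)
  - have c_a : (1 < #|crossing w a a|)%N by lia.
    have [a' [_ [/val_inj -> def_a]]] := crossing_ord (ltnW c_a).
    have [_ _ _ _ only_a] := tame_peak w_tame def_a c_a.
    have lt_ia : i < a.
      have : i != a by apply: contraTneq le_b => ->; lia.
      by rewrite -val_eqE /=; lia.
    have wa_i : w a != i by apply: contraTneq le_b => <-; rewrite wK; lia.
    have ei : i = a'.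
      case: (only_a i) => // [|e]; first by lia.
      by rewrite e eqxx in wa_i.
    exists i; split=> //; [lia | by left |].
    by move=> m; rewrite ei => ? ?; exists (w a); rewrite -?ei ?wK //; lia.
  - have e : a = i by apply: only; lia.
    by exists i; split=> //; [rewrite e | left | move=> m; rewrite -e; lia].
  by exists a; split=> //; [lia | right | lia].
have [q [le_bq le_qj w_q cov_q]] : exists q : 'I_n,
    [/\ b <= q, q <= w i, q = w i \/ w q = q & forall m : 'I_n, b < m -> m <= q ->
      exists2 x : 'I_n, x != i & x < m <= w x].
  have [lt_b | lt_b | /val_inj w_b] := ltngtP (w b) b.
  - have e : w b = i by apply: only; rewrite ?wK.
    by exists b; split=> //; [left; rewrite -e wK | lia].
  - have c_b : (1 < #|crossing w b.+1 b.+1|)%N by lia.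
    have [b' [b2 [def_b2 def_b']]] := crossing_ord (ltnW c_b).
    have e : b' = b by apply: val_inj => /=; lia.
    subst b'; rewrite -def_b2 in c_b.
    have [_ _ _ _ only_b] := tame_peak w_tame def_b' c_b.
    have lt_bi : b < w i.
      have : w i != b by apply: contraTneq lt_b => <-; rewrite wK; lia.
      by rewrite -val_eqE /=; lia.
    have ei : i = w b2.
      case: (only_b i) => // [| |e]; try lia.
      by rewrite e ltnn in lt_ib.
    exists (w i); split=> //; [by left |].
    move=> m; rewrite {1}ei wK => ? ?; exists b; last by lia.
    by rewrite -val_eqE /=; lia.
  by exists b; split=> //; [right | lia].
have lt_pq : p < q by lia.
have [u le_u [u_i u_p u_q u_j u_id]] := split_arc le_ip lt_pq le_qj erefl w_p w_q.
exists u => //; apply/setP => m; rewrite in_setD1; have [-> | ne] := eqVneq m b.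
  apply/mem_cuts => -[x x_b].
  have [e | xi] := eqVneq x i; first by move: x_b; rewrite e u_i; lia.
  have [e | xp] := eqVneq x p; first by move: x_b; rewrite e u_p; lia.
  have [e | xq] := eqVneq x q; first by move: x_b; rewrite e; lia.
  have [e | xj] := eqVneq x (w i); first by move: x_b; rewrite e; lia.
  move: x_b; rewrite u_id // => /andP[/only /[apply]] e.
  by rewrite e eqxx in xi.
rewrite /=; apply/idP/idP; first exact/subsetP/cuts_mono.
have {}ne : m != b :> nat by [].
case/mem_cuts=> x w_x; apply/mem_cuts.
(* Arcs other than the split one survive unchanged in [u]. *)
have other (y : 'I_n) : y != i -> y < m <= w y -> exists z : 'I_n, z < m <= u z.
  move=> yi w_y.
  have [e | yp] := eqVneq y p.
    by move: yi w_y; case: w_p => [<- | e2]; rewrite e ?eqxx // e2; lia.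
  have [e | yq] := eqVneq y q.
    by move: w_y; case: w_q => [e2 | e2]; rewrite e ?e2 ?wK; lia.
  have [e | yj] := eqVneq y (w i); first by move: w_y; rewrite e wK; lia.
  by exists y; rewrite u_id.
have [e | xi] := eqVneq x i; last exact: other w_x.
rewrite e in w_x.
have [le_mp | lt_pm] := leqP m p; first by exists i; rewrite u_i; lia.
have [lt_qm | le_mq] := ltnP q m; first by exists q; rewrite u_q; lia.
have [lt_mb | le_bm] := ltnP m b.
  by have [y yi w_y] := cov_p m lt_pm lt_mb; apply: other w_y.
by have [y yi w_y] := cov_q m ltac:(lia) le_mq; apply: other w_y.
Qed.

Lemma tame_sub_cuts n (w : involution n) (S : {set 'I_n}) :
  tame w -> S \subset cuts w -> exists2 u : involution n, bruhat_le u w & cuts u = S.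
Proof.
have [m] := ubnP #|cuts w :\: S|; elim: m w => // m IHm w le_m w_tame sub_S.
have [S_w | /set0Pn[k]] := eqVneq (cuts w :\: S) set0.
  exists w; first exact: connect0.
  by apply/eqP; rewrite eqEsubset sub_S andbT -setD_eq0 S_w.
rewrite inE => /andP[notS_k w_k].
have [v le_v cuts_v] := tame_remove_cut w_tame w_k.
have [||u le_u cuts_u] := IHm v _ (bruhat_tame le_v w_tame).
- suff: cuts v :\: S \proper cuts w :\: S by move=> /proper_card; lia.
  rewrite cuts_v; apply/properP; split; first by rewrite setSD ?subD1set.
  by exists k; rewrite !in_setD ?notS_k ?w_k // in_set1 eqxx.
- by rewrite cuts_v subsetD1 sub_S.
by exists u => //; apply: bruhat_trans le_v.
Qed.

(** The isomorphism sends [u] to its crossed cuts, renumbered through the enumeration of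
    [cuts w]. *)
Lemma tame_boolean n (w : involution n) : tame w -> boolean_involution w.
Proof.
move=> w_tame.
pose f (u : involution n) := [set t : 'I_#|cuts w| | enum_val t \in cuts u].
have f_E u t : (t \in f u) = (enum_val t \in cuts u) by rewrite in_set.
have below_cuts u : u \in bruhat_below w -> cuts u \subset cuts w.
  by rewrite inE; apply: cuts_mono.
have f_sub (u v : involution n) : u \in bruhat_below w ->
    (f u \subset f v) = (cuts u \subset cuts v).
  move=> le_u; apply/subsetP/subsetP => [sub_f k u_k | sub_c t].
    have w_k := subsetP (below_cuts u le_u) k u_k.
    have := sub_f (enum_rank_in w_k k).
    by rewrite !f_E !enum_rankK_in // => /(_ u_k).
  by rewrite !f_E; apply: sub_c.
have f_inj : {in bruhat_below w &, injective f}.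
  move=> u v le_u le_v eq_f; apply: (tame_cuts_inj w_tame) => //.
  by apply/eqP; rewrite eqEsubset -!f_sub // eq_f subxx.
exists #|cuts w|, f; split=> //.
  apply/setP => S; rewrite inE; apply/imsetP.
  have [||u le_u cuts_u] := @tame_sub_cuts n w [set enum_val t | t in S] => //.
    by apply/subsetP => _ /imsetP[t _ ->]; apply: enum_valP.
  exists u; first by rewrite inE.
  apply/setP => t; rewrite f_E cuts_u; apply/idP/imsetP => [S_t | [s S_s]].
    by exists t.
  by move/enum_val_inj->.
move=> u v le_u le_v; rewrite f_sub //; apply/idP/idP; last exact: cuts_mono.
have v_tame : tame v by apply: bruhat_tame w_tame; rewrite inE in le_v.
(* To reflect the order, descend from [v] to an [x] crossing exactly the cuts of [u]; injectivity
   identifies it with [u]. *)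
move/(tame_sub_cuts v_tame) => [x le_x cuts_x].
suff -> : u = x by [].
apply: (tame_cuts_inj w_tame) => //; rewrite !inE in le_v *.
exact: bruhat_trans le_v.
Qed.

(** * Motzkin paths *)

Lemma tnth_psi n (w : involution n) (i : 'I_n) :
  tnth (psi w) i = if i < w i then Up else if w i < i then Down else Flat.
Proof. by rewrite tnth_mktuple. Qed.

Lemma height_psi_crossing n (w : involution n) k :
  height (psi w) k = #|crossing w k k|%:Z%R.
Proof.
have wK := involutionK w.
rewrite height_psi -(cardsID [set i : 'I_n | k <= w i]).
(* Among the arcs opened before [k], [A] holds those still open and [B] those already closed, which
   cancel the deficiencies. *)
set A := _ :&: _; set B := _ :\: _.
have -> : A = crossing w k k by apply/setP => i; rewrite !inE; lia.
have -> : B = w @: [set i : 'I_n | (i < k) && (w i < i)].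
  apply/setP => i; rewrite inE; apply/idP/imsetP => [|[j + ->]].
    by rewrite !inE => lt_i; exists (w i); rewrite ?inE wK //; lia.
  by rewrite !inE wK; lia.
by rewrite card_imset ?PoszD ?addrK //; apply: perm_inj.
Qed.

Lemma tame_psi n (w : involution n) : tame w <-> nonnesting w /\ restricted (psi w).
Proof.
have Flat_fix x : (tnth (psi w) x == Flat) = (w x == x).
  by rewrite tnth_psi -[w x == x]val_eqE /=; case: ltngtP.
split=> [[w_nn w_le2 w_fix] | [w_nn /andP[/forallP w_le2 /forallP w_fix]]].
  split=> //; apply/andP; split; apply/forallP => k; rewrite height_psi_crossing.
    exact: w_le2.
  by rewrite Flat_fix; apply/implyP => /eqP/w_fix.
split=> // [k | x /eqP w_x].
  (* Tameness ranges over all natural [k]; past [n] nothing crosses. *)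
  have [lt_k | le_k] := ltnP k n.+1.
    by have := w_le2 (Ordinal lt_k); rewrite height_psi_crossing.
  rewrite (_ : crossing w k k = set0) ?cards0 //.
  by apply/setP => i; rewrite !inE; have := ltn_ord (w i); lia.
by have := w_fix x; rewrite height_psi_crossing Flat_fix w_x.
Qed.

Lemma psi_nonnesting_inj n (u v : involution n) :
  nonnesting u -> nonnesting v -> psi u = psi v -> u = v.
Proof.
move=> u_nn v_nn eq_psi; have eq_i i : tnth (psi u) i = tnth (psi v) i by rewrite eq_psi.
by apply: nonnesting_inj => // i; have := eq_i i; rewrite !tnth_psi;
  case: (ltngtP i (u i)); case: (ltngtP i (v i)).
Qed.

(** * First-in, first-out matching of steps *)

Definition count_before n (P : pred 'I_n) (k : nat) : nat :=
  #|[set i : 'I_n | (i < k) && P i]|.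

Lemma count_before_succ n (P : pred 'I_n) (i : 'I_n) :
  count_before P i.+1 = count_before P i + P i.
Proof.
rewrite /count_before (cardsD1 i) inE ltnSn /= addnC; congr (_ + _).
apply: eq_card => j; rewrite !inE -val_eqE /=; lia.
Qed.

Lemma count_before_mono n (P : pred 'I_n) k l :
  k <= l -> count_before P k <= count_before P l.
Proof.
by move=> le_kl; apply: subset_leq_card; apply/subsetP => i; rewrite !inE; lia.
Qed.

Lemma count_before_lt n (P : pred 'I_n) (i : 'I_n) k :
  P i -> i < k -> count_before P i < count_before P k.
Proof.
move=> P_i lt_ik; apply: leq_trans (count_before_mono P lt_ik).
by rewrite count_before_succ P_i addn1.
Qed.

Lemma count_before_inj n (P : pred 'I_n) :
  {in P &, injective (fun i : 'I_n => count_before P i)}.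
Proof.
move=> i j P_i P_j eq_c; apply: val_inj; case: (ltngtP i j) => //= lt.
  by have := count_before_lt P_i lt; rewrite eq_c ltnn.
by have := count_before_lt P_j lt; rewrite eq_c ltnn.
Qed.

Lemma count_before_surj n (P : pred 'I_n) c :
  c < count_before P n -> exists2 i : 'I_n, P i & count_before P i = c.
Proof.
suff IH k : k <= n -> c < count_before P k -> exists2 i : 'I_n, P i & count_before P i = c.
  exact: IH.
elim: k => [_|k IHk lt_kn].
  by rewrite /count_before (_ : [set i | _] = set0) ?cards0 //; apply/setP => i; rewrite !inE.
pose i := Ordinal lt_kn; rewrite (count_before_succ P i) /= => lt_c.
have [/IHk|le_c] := ltnP c (count_before P k); first by apply; apply: ltnW.
by exists i => /=; [case: (P i) lt_c | case: (P i) lt_c]; lia.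
Qed.

Definition is_up n (p : n.-tuple step) : pred 'I_n := fun i => tnth p i == Up.
Definition is_down n (p : n.-tuple step) : pred 'I_n := fun i => tnth p i == Down.

Lemma height_count n (p : n.-tuple step) k :
  height p k = ((count_before (is_up p) k)%:Z - (count_before (is_down p) k)%:Z)%R.
Proof.
rewrite /count_before -!sum1_card !(big_morph Posz PoszD (erefl (Posz 0))).
rewrite [X in (X - _)%R]big_mkcond [X in (_ - X)%R]big_mkcond -sumrB.
rewrite /height big_mkcond /=; apply: eq_bigr => i _.
by rewrite !inE /is_up /is_down; case: (i < k); case: (tnth p i).
Qed.

(* First in, first out: the m-th upstep is matched with the m-th downstep. *)
Definition fifo n (p : n.-tuple step) (x : 'I_n) : 'I_n :=
  match tnth p x with
  | Up => odflt x [pick y | is_down p y &&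
            (count_before (is_down p) y == count_before (is_up p) x)]
  | Down => odflt x [pick y | is_up p y &&
            (count_before (is_up p) y == count_before (is_down p) x)]
  | Flat => x
  end.

Lemma motzkin_count_le n (p : motzkin n) k :
  k <= n -> count_before (is_down p) k <= count_before (is_up p) k.
Proof.
move=> le_kn; have /andP[/forallP/(_ (Ordinal (le_kn : k < n.+1))) + _] := motzkinP p.
by rewrite height_count subr_ge0 lez_nat.
Qed.

Lemma motzkin_count_eq n (p : motzkin n) :
  count_before (is_down p) n = count_before (is_up p) n.
Proof.
by have /andP[_] := motzkinP p; rewrite height_count subr_eq0 eqz_nat => /eqP.
Qed.

(** The default in [fifo] is never taken: there are as many downsteps as upsteps, so every rank of
    an upstep is also that of a downstep. *)
Lemma fifo_up n (p : motzkin n) x : is_up p x ->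
  is_down p (fifo p x) /\ count_before (is_down p) (fifo p x) = count_before (is_up p) x.
Proof.
move=> up_x; rewrite /fifo (eqP up_x); case: pickP => [y /andP[? /eqP] //|none].
have [|y d_y c_y] := @count_before_surj n (is_down p) (count_before (is_up p) x).
  by rewrite motzkin_count_eq; apply: count_before_lt.
by have := none y; rewrite d_y c_y eqxx.
Qed.

Lemma fifo_down n (p : motzkin n) x : is_down p x ->
  is_up p (fifo p x) /\ count_before (is_up p) (fifo p x) = count_before (is_down p) x.
Proof.
move=> dn_x; rewrite /fifo (eqP dn_x); case: pickP => [y /andP[? /eqP] //|none].
have [|y d_y c_y] := @count_before_surj n (is_up p) (count_before (is_down p) x).
  by rewrite -motzkin_count_eq; apply: count_before_lt.
by have := none y; rewrite d_y c_y eqxx.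
Qed.

Lemma fifoK n (p : motzkin n) : involutive (fifo p).
Proof.
move=> x; case def_x: (tnth p x); last 1 first.
- have dn_x : is_down p x by rewrite /is_down def_x.
  have [up_y c_y] := fifo_down dn_x; have [dn_z c_z] := fifo_up up_y.
  by apply: (count_before_inj dn_z dn_x); rewrite c_z c_y.
- have up_x : is_up p x by rewrite /is_up def_x.
  have [dn_y c_y] := fifo_up up_x; have [up_z c_z] := fifo_down dn_y.
  by apply: (count_before_inj up_z up_x); rewrite c_z c_y.
by rewrite /fifo def_x def_x.
Qed.

(** If the partner came first, just after it the path would have more downsteps than upsteps and lie
    below the axis. *)
Lemma fifo_gt n (p : motzkin n) x : is_up p x -> x < fifo p x.
Proof.
move=> up_x; have [dn_y c_y] := fifo_up up_x; set y := fifo p x in dn_y c_y *.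
have ne : x != y :> nat.
  by rewrite val_eqE; apply: contraTneq dn_y => <-; rewrite /is_down (eqP up_x).
rewrite ltnNge; apply/negP => le_yx.
have := motzkin_count_le p (ltn_ord y); rewrite count_before_succ dn_y c_y.
have lt_yx : y < x by lia.
by have := count_before_mono (is_up p) lt_yx; lia.
Qed.

Lemma fifo_lt n (p : motzkin n) x : is_down p x -> fifo p x < x.
Proof. by case/fifo_down => up_y _; have := fifo_gt up_y; rewrite fifoK. Qed.

(** Matching by rank preserves the order of upsteps, hence never nests arcs. *)
Lemma psi_nonnesting_surj n (p : motzkin n) :
  exists2 w : involution n, nonnesting w & psi w = p.
Proof.
pose w := perm (can_inj (fifoK p)); have w_E : w =1 fifo p := permE _.
have wK : involutive w by move=> x; rewrite !w_E fifoK.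
have step_E x : tnth (psi_steps w) x = tnth p x.
  rewrite tnth_mktuple w_E; case def_x: (tnth p x).
  - by rewrite fifo_gt // /is_up def_x.
  - by rewrite /fifo def_x ltnn.
  - have lt_x : fifo p x < x by apply: fifo_lt; rewrite /is_down def_x.
    by rewrite lt_x; case: ltngtP lt_x.
exists (Involution (involutive_sqr wK)) => /=.
  move=> a b lt_ab; rewrite !w_E => lt_b.
  have [up_a|not_a] := boolP (is_up p a); last first.
    suff : fifo p a <= a by lia.
    rewrite /is_up in not_a; case def_a: (tnth p a) not_a => // _.
      by rewrite /fifo def_a.
    by apply: ltnW; apply: fifo_lt; rewrite /is_down def_a.
  have up_b : is_up p b.
    rewrite /is_up; case def_b: (tnth p b) => //.
      by move: lt_b; rewrite /fifo def_b ltnn.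
    by have := @fifo_lt n p b; rewrite /is_down def_b => /(_ isT); lia.
  rewrite ltnNge; apply/negP => /(count_before_mono (is_down p)).
  have [_ ->] := fifo_up up_a; have [_ ->] := fifo_up up_b.
  by have := count_before_lt up_a lt_ab; lia.
by apply: val_inj; apply: eq_from_tnth.
Qed.

Theorem proposition4p5 (n : nat) (hn : 1 <= n) :
  set_bij [set w : involution n | boolean_involution w]%classic
          [set p : motzkin n | restricted p]%classic
          (@psi n).
Proof.
split.
- by move=> w /= /boolean_tame/tame_psi[].
- move=> u v; rewrite !in_setE => /boolean_tame[u_nn _ _] /boolean_tame[v_nn _ _].
  exact: psi_nonnesting_inj.
move=> p /= p_restr; have [w w_nn psi_w] := psi_nonnesting_surj p.
by exists w => //; apply: tame_boolean; apply/tame_psi; rewrite psi_w.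
Qed.
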